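(* Let $n\ge2$, let $M\in\mathbb{R}^{n\times n}$ be a diagonal matrix and $\varepsilon\in\mathbb{R}$. The measure $$d\nu^*(x)=\left(\alpha\,x\cdot Mx+\beta\right)d\mu_0(x),\qquad\text{where }\ \alpha=-\frac{C_1}{C_2}\ \text{ and }\ \beta=-\int_{\mathcal{S}}\alpha\,x\cdot Mx\,d\mu_0(x),$$ fulfills $\int_{\mathcal{S}}d\nu^*=0$ and $d\tilde{\mathcal{E}}_\varepsilon(\nu^*,\nu')=0$ for all signed Radon measures $\nu'$ on $\mathcal{S}$ satisfying $\int_{\mathcal{S}}d\nu'=0$.
   Context: $\mathcal{S}=\{x\in\mathbb{R}^n:\|x\|=1\}$ is the Euclidean unit sphere and $\mu_0$ is the uniform probability distribution (normalized surface measure) on $\mathcal{S}$. For signed Radon measures $\nu$ on $\mathcal{S}$ with $\nu(\mathcal{S})=0$ define $$\tilde{\mathcal{E}}_\varepsilon(\nu)=\varepsilon^2\left(\int_{\mathcal{S}}\int_{\mathcal{S}}e^{x\cdot y}\,d\nu(x)\,d\nu(y)+2\int_{\mathcal{S}}\int_{\mathcal{S}}e^{x\cdot y}\,(x\cdot My)\,d\mu_0(x)\,d\nu(y)\right),$$ which is the second-order part in $\varepsilon$ of the energy $\int\int e^{x\cdot(\mathrm{Id}+\varepsilon M)y}\,d\mu\,d\mu$ along perturbations $\mu_0+\varepsilon\nu+\varepsilon^2w$ (up to terms independent of $\nu$). Its first variation in direction $\nu'$ (with $\nu'(\mathcal{S})=0$) is $$d\tilde{\mathcal{E}}_\varepsilon(\nu,\nu')=2\varepsilon^2\left(\int_{\mathcal{S}}\int_{\mathcal{S}}e^{x\cdot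 y}\,d\nu(x)\,d\nu'(y)+\int_{\mathcal{S}}\int_{\mathcal{S}}e^{x\cdot y}\,(x\cdot My)\,d\mu_0(x)\,d\nu'(y)\right).$$ The constants $C_1,C_2,C_3>0$, depending only on $n$, are those for which, for all $y\in\mathcal{S}$ and $1\le i\le n$, $$\int_{\mathcal{S}}e^{x\cdot y}\,x\,d\mu_0(x)=C_1\,y,\qquad\int_{\mathcal{S}}e^{x\cdot y}\,x_i^2\,d\mu_0(x)=C_2\,y_i^2+C_3 .$$ *)

(* Defs.v *)
From HB Require Import structures.
From mathcomp Require Import all_boot all_order all_algebra.
From mathcomp Require Import all_classical all_reals all_analysis.
From mathcomp Require Import measurable_realfun.
From mathcomp Require Import ring lra.

Set Implicit Arguments.
Unset Strict Implicit.
Unset Printing Implicit Defensive.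

Import Order.TTheory GRing.Theory Num.Theory.
Import numFieldNormedType.Exports.

Local Open Scope classical_set_scope.
Local Open Scope ring_scope.

(* Borel sigma-algebra of 'cV[R]_n. *)
Section borel_cV.
Variables (R : realType) (n : nat).
Let G : set (set 'cV[R]_n) := @open 'cV[R]_n.

Let borel0 : <<s G >> set0. Proof. exact: sigma_algebra0. Qed.
Let borelC A : <<s G >> A -> <<s G >> (~` A).
Proof. exact: sigma_algebraC. Qed.
Let borelU (F : (set 'cV[R]_n)^nat) :
  (forall i, <<s G >> (F i)) -> <<s G >> (\bigcup_i F i).
Proof. exact: sigma_algebra_bigcup. Qed.

HB.instance Definition _ := @isMeasurable.Build (sigma_display G)
  'cV[R]_n <<s G >> borel0 borelC borelU.
End borel_cV.

Section coordinates.
Variables (R : realType) (n : nat).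

Lemma measurable_coord (i : 'I_n) :
  measurable_fun [set: 'cV[R]_n] (fun x : 'cV[R]_n => x i 0).
Proof.
apply: (measurability _ (RGenOpens.measurableE R)).
move=> _ [_ [a [b ->]] <-]; rewrite setTI; apply: sub_sigma_algebra.
apply: open_comp; last exact: interval_open.
by move=> x _; exact: coord_continuous.
Qed.

Lemma measurable_fun_cVP d (T : measurableType d) (f : T -> 'cV[R]_n) :
  (forall i, measurable_fun setT (fun t => f t i 0)) -> measurable_fun setT f.
Proof.
move=> mf; apply: (@measurability _ _ T 'cV[R]_n setT f (@open 'cV[R]_n)) => //.
move=> _ [U oU <-]; rewrite setTI.
pose J := {ffun 'I_n -> rat * rat}.
pose box (c : J) : set 'cV[R]_n :=
  [set x | forall i, ball (ratr (c i).1 : R) (ratr (c i).2) (x i 0)].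
pose P (c : J) := `[< box c `<=` U >].
have -> : U = \bigcup_(c in [set c | P c]) box c.
  apply/seteqP; split => [x Ux|x [c /asboolP cU /cU]//].
  have /nbhs_ballP[e /= e0 eU] := open_nbhs_nbhs (conj oU Ux).
  have H i : exists c : rat * rat,
      x i 0 \in (ball (ratr c.1 : R) (ratr c.2) : set R) /\
      ball (ratr c.1 : R) (ratr c.2) `<=` ball (x i 0) e.
    have [] := @open_subball_rat R (ball (x i 0) e) (x i 0).
    - exact: ball_open.
    - by rewrite inE; exact: ballxx.
    - by move=> c [r cr]; exists (c, r).
  have /choice[c Hc] := H.
  exists [ffun i => c i].
    apply/asboolP => y; rewrite /box/= => Hy; apply: eU; split => // i j.
    by rewrite (ord1 j); have := Hy i; rewrite ffunE => /(Hc i).2.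
  by move=> i; rewrite ffunE; have [/set_mem] := Hc i.
rewrite preimage_bigcup bigcup_mkcond.
apply: countable_bigcupT_measurable => [|c]; first exact: countableP.
case: ifPn => // _.
rewrite [X in measurable X](_ : _ = \bigcap_(i in [set: 'I_n])
    ((fun t => f t i 0) @^-1` ball (ratr (c i).1 : R) (ratr (c i).2))); last first.
  by apply/seteqP; split => [t H i _|t H i]; [exact: (H i)|exact: (H i I)].
apply: fin_bigcap_measurable => [|i _]; first exact: finite_finset.
by rewrite -[X in measurable X]setTI; apply: mf => //; exact: measurable_ball.
Qed.

End coordinates.

Section lebesgue_cV.
Variable R : realType.
Local Open Scope ereal_scope.

Definition cons_cV n (p : R * 'cV[R]_n) : 'cV[R]_n.+1 :=
  \col_i oapp (fun j => p.2 j 0%R) p.1 (unlift ord0 i).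

Lemma measurable_cons_cV n : measurable_fun setT (@cons_cV n).
Proof.
apply: measurable_fun_cVP => i; rewrite (_ : (fun _ => _) = (fun p : R * 'cV[R]_n =>
    oapp (fun j => p.2 j 0%R) p.1 (unlift ord0 i))); last first.
  by apply/funext => p; rewrite mxE.
case: (unlift ord0 i) => [j|] /=; last exact: measurable_fst.
exact: (measurableT_comp (measurable_coord j) measurable_snd).
Qed.

Section step.
Variables (n : nat) (mu : {sigma_finite_measure set 'cV[R]_n -> \bar R}).

Definition lebesgue_cons : set 'cV[R]_n.+1 -> \bar R :=
  pushforward ((@lebesgue_measure R) \x mu) (@cons_cV n).

Let lebesgue_cons0 : lebesgue_cons set0 = 0.
Proof. by apply: measure0; exact: measurable_cons_cV. Qed.

Let lebesgue_cons_ge0 A : 0 <= lebesgue_cons A.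
Proof. by apply: measure_ge0; exact: measurable_cons_cV. Qed.

Let lebesgue_cons_sigma_additive : semi_sigma_additive lebesgue_cons.
Proof. by apply: measure_semi_sigma_additive; exact: measurable_cons_cV. Qed.

HB.instance Definition _ := isMeasure.Build _ _ _ lebesgue_cons
  lebesgue_cons0 lebesgue_cons_ge0 lebesgue_cons_sigma_additive.

Let uncons (x : 'cV[R]_n.+1) : R * 'cV[R]_n :=
  (x ord0 0%R, (\col_j x (lift ord0 j) 0%R)%R).

Let unconsK p : uncons (cons_cV p) = p.
Proof.
case: p => a v; rewrite /uncons /cons_cV; congr pair.
  by rewrite mxE unlift_none.
by apply/colP => j; rewrite !mxE liftK.
Qed.

Let measurable_uncons : measurable_fun setT uncons.
Proof.
apply/measurable_fun_pairP; split; first exact: measurable_coord.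
apply: measurable_fun_cVP => i; rewrite /comp/=.
by under eq_fun do rewrite mxE; exact: measurable_coord.
Qed.

Let lebesgue_cons_sigma_finite : sigma_finite setT lebesgue_cons.
Proof.
have /sigma_finiteP[F [TF ndF Foo]] := sigma_finiteT (@lebesgue_measure R).
have /sigma_finiteP[G [TG ndG Goo]] := sigma_finiteT mu.
exists (fun k => uncons @^-1` (F k `*` G k)).
  rewrite -preimage_bigcup (_ : \bigcup_k _ = setT) ?preimage_setT//.
  apply/seteqP; split => // -[a v] _.
  have [i _ Fi] : (\bigcup_k F k) a by rewrite -TF.
  have [j _ Gj] : (\bigcup_k G k) v by rewrite -TG.
  exists (maxn i j) => //; split => /=.
  - by move: a Fi; exact/subsetPset/ndF/leq_maxl.
  - by move: v Gj; exact/subsetPset/ndG/leq_maxr.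
move=> k; have [mF Fk] := Foo k; have [mG Gk] := Goo k; split.
  by rewrite -[X in measurable X]setTI; apply: measurable_uncons => //;
    exact: measurableX.
rewrite /lebesgue_cons /pushforward -comp_preimage.
rewrite (_ : uncons \o _ = id); last by apply/funext => p /=; rewrite unconsK.
by rewrite preimage_id product_measure1E// lte_mul_pinfty// ge0_fin_numE.
Qed.

HB.instance Definition _ := Measure_isSigmaFinite.Build _ _ _ lebesgue_cons
  lebesgue_cons_sigma_finite.

End step.

Fixpoint lebesgue_cV n : {sigma_finite_measure set 'cV[R]_n -> \bar R} :=
  if n is m.+1 then lebesgue_cons (lebesgue_cV m) else \d_(0%R : 'cV[R]_0).

Lemma lebesgue_cV_box n (A : 'I_n -> set R) : (forall i, measurable (A i)) ->
  lebesgue_cV n [set x : 'cV[R]_n | forall i, A i (x i 0%R)] =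
  \prod_(i < n) lebesgue_measure (A i).
Proof.
elim: n A => [|n ih] A mA /=.
  rewrite big_ord0 /dirac indicE mem_set//=; by case.
rewrite big_ord_recl -ih; last by move=> i; exact: mA.
have mB : measurable [set x : 'cV[R]_n | forall i, A (lift ord0 i) (x i 0%R)].
  rewrite [X in measurable X](_ : _ = \bigcap_(i in [set: 'I_n])
    ((fun x : 'cV[R]_n => x i 0%R) @^-1` A (lift ord0 i))); last first.
    by apply/seteqP; split => [t H i _|t H i]; [exact: (H i)|exact: (H i I)].
  apply: fin_bigcap_measurable => [|i _]; first exact: finite_finset.
  by rewrite -[X in measurable X]setTI; apply: measurable_coord.
refine (eq_trans _
  (product_measure1E lebesgue_measure (lebesgue_cV n) (mA ord0) mB)).
rewrite /lebesgue_cons /pushforward; congr (product_measure1 _ _ _).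
apply/seteqP; split => -[a v]/=.
  move=> H; split; first by have := H ord0; rewrite mxE unlift_none.
  by move=> i; have := H (lift ord0 i); rewrite mxE liftK.
case=> Ha Hv i; rewrite mxE; case: unliftP => [j ->|->]//=; exact: Hv.
Qed.

End lebesgue_cV.

Section euclidean.
Variables (R : realType) (n : nat).

Implicit Types x y : 'cV[R]_n.

Definition dotp (x y : 'cV[R]_n) : R := \sum_(i < n) x i 0 * y i 0.

Definition enorm (x : 'cV[R]_n) : R := Num.sqrt (dotp x x).

Lemma dotp_ge0 x : 0 <= dotp x x.
Proof. by apply: sumr_ge0 => i _; rewrite -expr2 sqr_ge0. Qed.

Lemma enorm_ge0 x : 0 <= enorm x.
Proof. exact: sqrtr_ge0. Qed.

Lemma enormZ r x : enorm (r *: x) = `|r| * enorm x.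
Proof.
rewrite /enorm (_ : dotp _ _ = r ^+ 2 * dotp x x); last first.
  by rewrite /dotp mulr_sumr; apply: eq_bigr => i _; rewrite !mxE; ring.
by rewrite sqrtrM ?sqr_ge0// sqrtr_sqr.
Qed.

Lemma coord_le_enorm x i : `|x i 0| <= enorm x.
Proof.
rewrite -sqrtr_sqr; apply: ler_wsqrtr; rewrite /dotp (bigD1 i)//= expr2.
by rewrite lerDl sumr_ge0// => j _; rewrite -expr2 sqr_ge0.
Qed.

Lemma measurable_enorm : measurable_fun setT enorm.
Proof.
apply: (@measurableT_comp _ _ _ _ _ _ (@Num.sqrt R)).
  by apply: continuous_measurable_fun; exact: sqrt_continuous.
apply: measurable_sum => i.
by apply: measurable_funM; exact: measurable_coord.
Qed.

Lemma measurable_normalize :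
  measurable_fun setT (fun x : 'cV[R]_n => (enorm x)^-1 *: x).
Proof.
have minv : measurable_fun setT (@GRing.inv R).
  rewrite -(setvU [set (0 : R)]); apply/measurable_funU => //.
    by apply: measurableC.
  split; last exact: measurable_fun_set1.
  apply: open_continuous_measurable_fun.
    exact/closed_openC/closed_eq.
  by move=> x /set_mem/= /eqP x0; exact: inv_continuous.
apply: measurable_fun_cVP => i.
rewrite (_ : (fun _ => _) = (fun x : 'cV[R]_n => (enorm x)^-1 * x i 0)).
  apply: measurable_funM; last exact: measurable_coord.
  exact: (measurableT_comp minv measurable_enorm).
by apply/funext => x; rewrite mxE.
Qed.

End euclidean.

Definition sphere (R : realType) (n : nat) : set 'cV[R]_n :=
  [set x | enorm x = 1].

(* The sphere as a measurable space; as such spaces are pointed, the ambient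
   dimension is a successor. *)
Definition sphereType (R : realType) (n : nat) : Type :=
  set_type (@sphere R n.+1).

HB.instance Definition _ (R : realType) (n : nat) :=
  Topological.copy (sphereType R n) (set_type (@sphere R n.+1)).

Definition vec (R : realType) (n : nat) (x : sphereType R n) :
  'cV[R]_n.+1 := set_val x.

Section sphere.
Variables (R : realType) (n : nat).
Implicit Types (x : sphereType R n) (A : set (sphereType R n)).

Lemma enorm_sphere x : enorm (vec x) = 1.
Proof. exact: (set_mem (svalP x)). Qed.

Lemma sphere_ex (y : 'cV[R]_n.+1) :
  sphere y -> exists x : sphereType R n, vec x = y.
Proof. by move=> Sy; exists (SigSub (mem_set Sy)). Qed.

Lemma sphere_delta : sphere (delta_mx 0 0 : 'cV[R]_n.+1).
Proof.
rewrite /sphere/= /enorm /dotp (bigD1 ord0)//= !mxE !eqxx mulr1 big1 ?addr0.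
  exact: sqrtr1.
by move=> i /negPf i0; rewrite !mxE i0 mul0r.
Qed.

HB.instance Definition _ := isPointed.Build (sphereType R n)
  (SigSub (mem_set sphere_delta)).

Let G : set (set (sphereType R n)) := @open (sphereType R n).

Let sphere0 : <<s G >> set0. Proof. exact: sigma_algebra0. Qed.
Let sphereC A : <<s G >> A -> <<s G >> (~` A).
Proof. exact: sigma_algebraC. Qed.
Let sphereU (F : (set (sphereType R n))^nat) :
  (forall i, <<s G >> (F i)) -> <<s G >> (\bigcup_i F i).
Proof. exact: sigma_algebra_bigcup. Qed.

HB.instance Definition _ := @isMeasurable.Build (sigma_display G)
  (sphereType R n) <<s G >> sphere0 sphereC sphereU.

Lemma measurable_vec : measurable_fun setT (@vec R n).
Proof.
apply: (@measurability _ _ (sphereType R n) 'cV[R]_n.+1 setT _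
  (@open 'cV[R]_n.+1)) => //.
move=> _ [U oU <-]; rewrite setTI; apply: sub_sigma_algebra.
by exists U.
Qed.

Lemma measurable_sphereP A : measurable A ->
  exists2 V : set 'cV[R]_n.+1, measurable V & A = @vec R n @^-1` V.
Proof.
have sub : <<s G >> `<=` preimage_set_system setT (@vec R n) measurable.
  apply: smallest_sub.
    exact/sigma_algebra_preimage/sigma_algebra_measurable.
  move=> _ [V oV <-]; exists V; first exact: sub_sigma_algebra.
  by rewrite setTI.
by move=> mA; have [V mV <-] := sub _ mA; exists V => //; rewrite setTI.
Qed.

(* The cone {r x : 0 < r <= 1, x in A}. *)
Definition cone A : set 'cV[R]_n.+1 :=
  [set r *: vec x | r in `]0, 1] & x in A].

Lemma coneE A : cone A = [set y | 0 < enorm y <= 1 /\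
  exists2 x, A x & vec x = (enorm y)^-1 *: y].
Proof.
apply/seteqP; split => [_ [r + [x Ax <-]]|y [/andP[y0 y1] [x Ax xy]]].
  rewrite /= in_itv/= => /andP[r0 r1].
  rewrite enormZ enorm_sphere mulr1 gtr0_norm//; split; first by rewrite r0.
  by exists x => //; rewrite scalerA mulVf ?scale1r// gt_eqF.
exists (enorm y); first by rewrite /= in_itv/= y0.
by exists x => //; rewrite xy scalerA divff ?scale1r// gt_eqF.
Qed.

Lemma measurable_cone A : measurable A -> measurable (cone A).
Proof.
move=> /measurable_sphereP[V mV ->].
rewrite coneE (_ : mkset _ = @enorm R n.+1 @^-1` `]0, 1] `&`
    (fun y : 'cV[R]_n.+1 => (enorm y)^-1 *: y) @^-1` V).
  apply: measurableI; rewrite -[X in measurable X]setTI.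
    by apply: measurable_enorm => //; exact: measurable_itv.
  exact: measurable_normalize.
apply/seteqP; split => y /=; rewrite in_itv/=.
  by move=> [y01 [x Vx <-]].
move=> [/andP[y0 y1] Vy]; split; first by rewrite y0.
have Sy : sphere ((enorm y)^-1 *: y).
  by rewrite /sphere/= enormZ ger0_norm ?invr_ge0 ?enorm_ge0// mulVf// gt_eqF.
by have [x xE] := sphere_ex Sy; exists x; rewrite //= xE.
Qed.

Local Open Scope ereal_scope.

(* Up to the factor n.+1, the surface measure on the unit sphere of R^n.+1. *)
Definition cone_measure A : \bar R := lebesgue_cV R n.+1 (cone A).

Let cone_measure0 : cone_measure set0 = 0.
Proof.
rewrite /cone_measure (_ : cone _ = set0) ?measure0//.
by apply/seteqP; split => // y [r _ [x []]].
Qed.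

Let cone_measure_ge0 A : 0 <= cone_measure A.
Proof. exact: measure_ge0. Qed.

Let cone_bigcup (F : (set (sphereType R n))^nat) :
  cone (\bigcup_i F i) = \bigcup_i cone (F i).
Proof.
apply/seteqP; split => [_ [r r01 [x [i _ Fx] <-]]|_ [i _ [r r01 [x Fx <-]]]].
  by exists i => //; exists r => //; exists x.
by exists r => //; exists x => //; exists i.
Qed.

Let cone_measure_sigma_additive : semi_sigma_additive cone_measure.
Proof.
move=> F mF tF mUF; rewrite /cone_measure cone_bigcup.
apply: measure_semi_sigma_additive.
- by move=> i; exact: measurable_cone.
- move=> i j _ _ [y []]; rewrite !coneE => -[_ [x Fx xE]] [_ [z Fz zE]].
  apply: (tF i j I I); exists x; split => //.
  by rewrite (_ : x = z)//; apply/val_inj; exact: etrans xE (esym zE).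
- by rewrite -cone_bigcup; exact: measurable_cone.
Qed.

HB.instance Definition _ := isMeasure.Build _ _ _ cone_measure
  cone_measure0 cone_measure_ge0 cone_measure_sigma_additive.

Let lebesgue_cube (a b : R) : (a <= b)%R ->
  lebesgue_cV R n.+1 [set x : 'cV[R]_n.+1 | forall i, `]a, b]%classic (x i 0%R)] =
  ((b - a) ^+ n.+1)%:E.
Proof.
move=> ab; have := @lebesgue_cV_box R n.+1 (fun=> `]a, b]%classic).
move=> ->; last by move=> i; exact: measurable_itv.
rewrite (eq_bigr (fun=> (b - a)%:E)); last first.
  move=> i _; rewrite lebesgue_measure_itv/= lte_fin.
  case: ltP => // ba; rewrite (_ : b = a) ?subrr//.
  by apply/eqP; rewrite eq_le ba ab.
by rewrite prodEFin prodr_const card_ord.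
Qed.

Let measurable_cube (a b : R) : measurable
  [set x : 'cV[R]_n.+1 | forall i, `]a, b]%classic (x i 0%R)].
Proof.
rewrite [X in measurable X](_ : _ = \bigcap_(i in [set: 'I_n.+1])
  ((fun x : 'cV[R]_n.+1 => x i 0%R) @^-1` `]a, b])); last first.
  by apply/seteqP; split => [t H i _|t H i]; [exact: (H i)|exact: (H i I)].
apply: fin_bigcap_measurable => [|i _]; first exact: finite_finset.
by rewrite -[X in measurable X]setTI; apply: measurable_coord.
Qed.

Lemma cone_measureT_lty : cone_measure setT < +oo.
Proof.
apply: (@le_lt_trans _ _ (lebesgue_cV R n.+1
    [set x : 'cV[R]_n.+1 | forall i, `](-2)%R, 2%R]%classic (x i 0%R)])).
  apply: le_measure; rewrite ?inE//; first exact: measurable_cone.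
  rewrite coneE => y [/andP[_ y1] _] i; rewrite /= in_itv/=.
  have := le_trans (coord_le_enorm y i) y1; rewrite ler_norml => /andP[? ?].
  by apply/andP; split; lra.
by rewrite lebesgue_cube ?ltry//; lra.
Qed.

Lemma cone_measureT_gt0 : 0 < cone_measure setT.
Proof.
pose a : R := (n.+1%:R^-1)%R.
have a0 : (0 < a)%R by rewrite invr_gt0.
apply: (@lt_le_trans _ _ (lebesgue_cV R n.+1
    [set x : 'cV[R]_n.+1 | forall i, `]0%R, a]%classic (x i 0%R)])).
  by rewrite lebesgue_cube ?subr0 ?lte_fin ?exprn_gt0// ltW.
apply: le_measure; rewrite ?inE//; first exact: measurable_cone.
move=> y Hy.
have {}Hy i : (0 < y i ord0 <= a)%R by have := Hy i; rewrite /= in_itv.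
have y0 : (0 < enorm y)%R.
  have /andP[y0 _] := Hy ord0; apply: lt_le_trans (coord_le_enorm y ord0).
  by rewrite gtr0_norm.
rewrite coneE; split; first rewrite y0/=.
  rewrite -(@sqrtr1 R); apply: ler_wsqrtr.
  apply: (@le_trans _ _ (\sum_(i < n.+1) a)%R).
    apply: ler_sum => i _; have /andP[yi0 yia] := Hy i.
    rewrite -[leRHS]mulr1; apply: ler_pM => //; [exact: ltW|exact: ltW|].
    by rewrite (le_trans yia)// invf_le1// ler1n.
  by rewrite sumr_const card_ord -mulr_natl mulfV// pnatr_eq0.
have Sy : sphere ((enorm y)^-1 *: y)%R.
  by rewrite /sphere/= enormZ ger0_norm ?invr_ge0 ?enorm_ge0// mulVf// gt_eqF.
by have [x xE] := sphere_ex Sy; exists x.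
Qed.

(* Normalized surface measure. *)
Definition uniform_sphere A : \bar R :=
  ((fine (cone_measure setT))^-1)%:E * cone_measure A.

Let c_ge0 : (0 <= (fine (cone_measure setT))^-1)%R.
Proof. by rewrite invr_ge0 fine_ge0. Qed.

Let uniform_sphere0 : uniform_sphere set0 = 0.
Proof. by rewrite /uniform_sphere measure0 mule0. Qed.

Let uniform_sphere_ge0 A : 0 <= uniform_sphere A.
Proof. by rewrite mule_ge0// lee_fin. Qed.

Let uniform_sphere_sigma_additive : semi_sigma_additive uniform_sphere.
Proof. exact: (@measure_semi_sigma_additive _ _ _ (mscale (NngNum c_ge0) cone_measure)). Qed.

HB.instance Definition _ := isMeasure.Build _ _ _ uniform_sphere
  uniform_sphere0 uniform_sphere_ge0 uniform_sphere_sigma_additive.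

Let uniform_sphereT : uniform_sphere setT = 1.
Proof.
have fT : cone_measure setT \is a fin_num.
  by rewrite ge0_fin_numE// cone_measureT_lty.
rewrite /uniform_sphere -[X in _ * X]fineK// -EFinM mulVf//.
by rewrite gt_eqF// fine_gt0// cone_measureT_gt0 cone_measureT_lty.
Qed.

HB.instance Definition _ := Measure_isProbability.Build _ _ _ uniform_sphere
  uniform_sphereT.

End sphere.

Section charge_integral.
Context d (T : measurableType d) (R : realType).
Variable nu : {charge set T -> \bar R}.

Lemma hahn_ex : exists PN : set T * set T, hahn_decomposition nu PN.1 PN.2.
Proof. by have [P [N PN]] := Hahn_decomposition nu; exists (P, N). Qed.

(* The integral against nu^+ minus the integral against nu^-; by uniqueness of
   the Jordan decomposition, the chosen Hahn decomposition is irrelevant. *)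
Definition charge_integral (f : T -> R) : R :=
  let PN := svalP (cid hahn_ex) in
  \int[jordan_pos PN]_x f x - \int[jordan_neg PN]_x f x.

End charge_integral.

Section density.
Variables (R : realType) (n : nat) (M : 'M[R]_n.+1) (alpha beta : R).

Definition quad_density (x : sphereType R n) : R :=
  alpha * dotp (vec x) (M *m vec x) + beta.

Lemma quad_density_integrable :
  (@uniform_sphere R n).-integrable setT (EFin \o quad_density).
Proof.
have mcoord i : measurable_fun setT (fun x : sphereType R n => vec x i 0).
  exact: (measurableT_comp (measurable_coord i) (@measurable_vec R n)).
apply: measurable_bounded_integrable => //.
- by apply: (le_lt_trans (probability_le1 (@uniform_sphere R n) measurableT)); rewrite ltry.
- apply: measurable_funD => //; apply: measurable_funM => //.
  apply: measurable_sum => i; apply: measurable_funM => //.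
  rewrite (_ : (fun _ => _) =
      (fun x : sphereType R n => \sum_j M i j * vec x j 0)).
    by apply: measurable_sum => j; apply: measurable_funM.
  by apply/funext => x; rewrite mxE.
have bound (x : sphereType R n) :
    `|quad_density x| <= `|alpha| * (\sum_i \sum_j `|M i j|) + `|beta|.
  have x1 i : `|vec x i 0| <= 1.
    by rewrite -(enorm_sphere x); exact: coord_le_enorm.
  apply: le_trans (ler_normD _ _) _; rewrite lerD2r normrM.
  apply: ler_wpM2l => //; apply: le_trans (ler_norm_sum _ _ _) _.
  apply: ler_sum => i _; rewrite normrM mxE.
  rewrite -[leRHS]mul1r; apply: ler_pM => //.
  apply: le_trans (ler_norm_sum _ _ _) _.
  apply: ler_sum => j _; rewrite normrM -[leRHS]mulr1.
  exact: ler_pM.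
exists (`|alpha| * (\sum_i \sum_j `|M i j|) + `|beta|).
by split; [exact: num_real|move=> K /ltW lK x _; exact: le_trans (bound x) lK].
Qed.

(* The signed measure (alpha x . M x + beta) d mu_0. *)
Definition quad_charge : {charge set (sphereType R n) -> \bar R} :=
  induced_charge quad_density_integrable.

End density.

(* The first variation at nu in direction nu' of
     eps^2 (\int\int e^(x.y) d nu(x) d nu(y)
            + 2 \int\int e^(x.y) (x . M y) d mu_0(x) d nu(y));
   the inner integrals are over x and the outer ones over y. *)
Definition energy_variation (R : realType) (n : nat) (M : 'M[R]_n.+1) (eps : R)
    (nu nu' : {charge set (sphereType R n) -> \bar R}) : R :=
  2 * eps ^+ 2 *
  (charge_integral nu' (fun y => charge_integral nu (fun x => expR (dotp (vec x) (vec y))))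
   + charge_integral nu' (fun y =>
       \int[@uniform_sphere R n]_x (expR (dotp (vec x) (vec y)) * dotp (vec x) (M *m vec y)))).

(* Main.v *)
Require Import Defs.
From mathcomp Require Import all_boot all_order all_algebra.
From mathcomp Require Import all_classical all_reals all_analysis.
From mathcomp Require Import measurable_realfun ring.

Set Implicit Arguments.
Unset Strict Implicit.
Unset Printing Implicit Defensive.

Import Order.TTheory GRing.Theory Num.Theory.

Local Open Scope classical_set_scope.
Local Open Scope ring_scope.

(** Integrating the kernel [e^(x.y)] against a charge in [x] gives a function
of [y], its potential, and the first variation in direction [nu'] is, up to the
factor [2 eps^2], the integral against [nu'] of the sum of two potentials: that
of [nu*], and that of [x.My] with respect to [mu0].  For [M] diagonal the
hypotheses on [C1], [C2] and [C3] evaluate every potential involved: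

- [x.My] has the potential [C1 (y.My)], by linearity
  ([kernel_linear_potential]);
- [x.Mx] is a combination of the squares [x_i^2], so its potential is
  [C2 (y.My) + C3 tr M] ([kernel_quad_potential]);
- the constant [1] is [x.x] on the sphere, which is the case [M = Id] of the
  preceding item, so its potential does not depend on [y]
  ([kernel_potential]).

The potential of [nu*] is therefore [alpha C2 (y.My)] plus a constant
([quad_charge_potential]).  The choice [alpha = - C1 / C2] makes the quadratic
terms cancel, what remains is constant in [y], and a charge of total mass zero
annihilates constants ([charge_integral_cst]).  The total mass of [nu*] vanishes
because [mu0] is a probability and [beta] subtracts the mean of the
quadratic term.

The measure-theoretic point is that the integral against [nu*], which is defined
through a Hahn decomposition, is the integral against [mu0] of the product with
the density ([charge_integral_induced]).  The two Jordan parts of a charge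
[f dmu] are absolutely continuous with respect to [mu]; the difference of their
Radon-Nikodym derivatives has the same integral as [f] over every measurable
set, hence is [f] almost everywhere. *)

(** * Bounded measurable functions *)

Section bounded_measurable.
Context d (T : measurableType d) (R : realType).
Implicit Types f g : T -> R.

(** These functions are integrable against every finite measure, hence against
both Jordan parts of any charge: they form the class on which
[charge_integral] is linear. *)
Definition bounded_measurable f :=
  measurable_fun setT f /\ exists K, forall x, `|f x| <= K.

Lemma bounded_measurable_cst c : bounded_measurable (fun=> c).
Proof. by split; [exact: measurable_cst | exists `|c|]. Qed.

Lemma bounded_measurableD f g : bounded_measurable f -> bounded_measurable g ->
  bounded_measurable (fun x => f x + g x).
Proof.
move=> [mf [K fK]] [mg [L gL]]; split; first exact: measurable_funD.
by exists (K + L) => x; apply: le_trans (ler_normD _ _) (lerD _ _).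
Qed.

Lemma bounded_measurableM f g : bounded_measurable f -> bounded_measurable g ->
  bounded_measurable (fun x => f x * g x).
Proof.
move=> [mf [K fK]] [mg [L gL]]; split; first exact: measurable_funM.
by exists (K * L) => x; rewrite normrM ler_pM.
Qed.

Lemma bounded_measurable_sum m (h : 'I_m -> T -> R) :
  (forall i, bounded_measurable (h i)) ->
  bounded_measurable (fun x => \sum_(i < m) h i x).
Proof.
move=> bh; split; first by apply: measurable_sum => i; exact: (bh i).1.
have /choice[K hK] := fun i => (bh i).2.
exists (\sum_(i < m) K i) => x; apply: le_trans (ler_norm_sum _ _ _) _.
by apply: ler_sum => i _; exact: hK.
Qed.

Lemma bounded_measurable_expR f : bounded_measurable f ->
  bounded_measurable (fun x => expR (f x)).
Proof.
move=> [mf [K fK]]; split; first exact: measurableT_comp.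
exists (expR K) => x; rewrite ger0_norm ?expR_ge0// ler_expR.
exact: le_trans (ler_norm _) (fK x).
Qed.

Lemma bounded_measurable_bounded f :
  bounded_measurable f -> [bounded f x | x in setT].
Proof.
move=> [_ [K fK]]; exists K; split; first exact: num_real.
by move=> L /ltW KL x _; exact: le_trans (fK x) KL.
Qed.

Lemma bounded_measurable_integrable (mu : {finite_measure set T -> \bar R}) f :
  bounded_measurable f -> mu.-integrable setT (EFin \o f).
Proof.
move=> bf; apply: measurable_bounded_integrable => //.
- by rewrite -ge0_fin_numE// fin_num_measure.
- exact: bf.1.
- exact: bounded_measurable_bounded.
Qed.

End bounded_measurable.

(** * Integration against a charge *)

Section charge_integral.
Context d (T : measurableType d) (R : realType).
Implicit Types (nu : {charge set T -> \bar R}) (f g : T -> R).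

Lemma chargeE_jordan nu P N (PN : hahn_decomposition nu P N) A :
  measurable A -> nu A = (jordan_pos PN A - jordan_neg PN A)%E.
Proof. by move=> mA; rewrite [LHS](jordan_decomp PN mA) /cadd/= cscaleN1. Qed.

Lemma charge_integralD nu f g : bounded_measurable f -> bounded_measurable g ->
  charge_integral nu (fun x => f x + g x) =
  charge_integral nu f + charge_integral nu g.
Proof.
move=> bf bg; rewrite /charge_integral.
by rewrite !RintegralD//; try exact: bounded_measurable_integrable; ring.
Qed.

(** In particular constants are invisible to a charge of total mass zero. *)
Lemma charge_integral_cst nu c :
  charge_integral nu (fun=> c) = c * fine (nu setT).
Proof.
rewrite /charge_integral; set PN := svalP _.
rewrite !Rintegral_cst// -mulrBr; congr (_ * _).
by rewrite (chargeE_jordan PN measurableT) fineB// fin_num_measure.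
Qed.

Lemma induced_charge_dominates (mu : {measure set T -> \bar R})
    (f : T -> \bar R) (intf : mu.-integrable setT f) :
  induced_charge intf `<< mu.
Proof.
apply/null_content_dominatesP => A mA muA0.
apply: null_set_integral => //.
by apply: measurable_funTS; exact: measurable_int intf.
Qed.

(** The density [f] need not be the difference [p - q] of the Radon-Nikodym
derivatives of the Jordan parts everywhere, but both integrate to the charge of
every measurable set, so they agree almost everywhere. *)
Lemma charge_integral_induced (mu : {sigma_finite_measure set T -> \bar R})
    f (intf : mu.-integrable setT (EFin \o f)) g : bounded_measurable g ->
  charge_integral (induced_charge intf) g = \int[mu]_x (g x * f x).
Proof.
move=> bg; rewrite /charge_integral; set PN := svalP _.
set pos := jordan_pos PN; set neg := jordan_neg PN.
have posmu : pos `<< mu by apply/jordan_pos_dominates/induced_charge_dominates.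
have negmu : neg `<< mu by apply/jordan_neg_dominates/induced_charge_dominates.
pose p := Radon_Nikodym (charge_of_finite_measure pos) mu.
pose q := Radon_Nikodym (charge_of_finite_measure neg) mu.
have ip : mu.-integrable setT p by exact: Radon_Nikodym_integrable.
have iq : mu.-integrable setT q by exact: Radon_Nikodym_integrable.
have mg : measurable_fun setT (EFin \o g) by apply/measurable_EFinP; exact: bg.1.
have igM h : mu.-integrable setT h -> mu.-integrable setT ((EFin \o g) \* h)%E.
  by apply: integrableMr => //; [exact: bg.1|exact: bounded_measurable_bounded].
have posE : (\int[pos]_x (g x)%:E = \int[mu]_x ((g x)%:E * p x))%E.
  rewrite -(Radon_Nikodym_change_of_variables posmu)//.
  exact: bounded_measurable_integrable.
have negE : (\int[neg]_x (g x)%:E = \int[mu]_x ((g x)%:E * q x))%E.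
  rewrite -(Radon_Nikodym_change_of_variables negmu)//.
  exact: bounded_measurable_integrable.
have pqf : ae_eq mu setT (p \- q)%E (EFin \o f).
  apply: integral_ae_eq => //; [exact: integrableB|exact: measurable_int intf|].
  move=> E _ mE; rewrite integralB//; [|exact: integrableS measurableT mE _ _..].
  rewrite -!Radon_Nikodym_integral// -[RHS]/(induced_charge intf E).
  by rewrite (chargeE_jordan PN mE).
rewrite /Rintegral posE negE -fineB; last 2 first.
- exact/integrable_fin_num/igM.
- exact/integrable_fin_num/igM.
rewrite -integralB//; [|exact: igM..].
congr fine; apply: ae_eq_integral => //.
- apply: emeasurable_funB; exact: measurable_int (igM _ _).
- exact: measurable_int (igM _ intf).
- have := ae_eqe_mul2l (EFin \o g) pqf.
  apply: filterS => x + _ => /(_ I) /= E; rewrite EFinM -E.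
  by rewrite muleBr// fin_num_adde_defr// Radon_Nikodym_fin_num.
Qed.

End charge_integral.

(** * Potentials of quadratic densities on the sphere *)

Lemma Rintegral_lincomb d (T : measurableType d) (R : realType)
    (mu : {finite_measure set T -> \bar R}) m (a : 'I_m -> R)
    (h : 'I_m -> T -> R) : (forall i, bounded_measurable (h i)) ->
  \int[mu]_x (\sum_(i < m) a i * h i x) = \sum_(i < m) a i * \int[mu]_x h i x.
Proof.
elim: m a h => [|m ih] a h bh.
  by under eq_Rintegral do rewrite big_ord0; rewrite Rintegral_cst// mul0r big_ord0.
under eq_Rintegral do rewrite big_ord_recl.
have bah i : bounded_measurable (fun x => a i * h i x).
  by apply: bounded_measurableM; [exact: bounded_measurable_cst|exact: bh].
rewrite RintegralD//; last 2 first.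
- exact: bounded_measurable_integrable.
- exact/bounded_measurable_integrable/bounded_measurable_sum.
rewrite RintegralZl//; last exact: bounded_measurable_integrable.
by rewrite ih// big_ord_recl.
Qed.

Lemma dotp_diag (R : realType) n (M : 'M[R]_n) (x y : 'cV[R]_n) :
  is_diag_mx M -> dotp x (M *m y) = \sum_(i < n) M i i * (x i 0 * y i 0).
Proof.
move=> /is_diag_mxP M_diag; apply: eq_bigr => i _.
rewrite mxE (bigD1 i)//= big1 ?addr0; first by ring.
by move=> j ji; rewrite M_diag ?mul0r// eq_sym.
Qed.

Section sphere.
Context (R : realType) (n : nat).
Implicit Types (x y : sphereType R n) (M : 'M[R]_n.+1).
Local Notation mu0 := (@uniform_sphere R n).

Lemma sum_sqr_sphere x : \sum_i vec x i 0 ^+ 2 = 1.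
Proof.
have : enorm (vec x) ^+ 2 = 1 by rewrite enorm_sphere expr1n.
by rewrite sqr_sqrtr ?dotp_ge0// => <-; apply: eq_bigr => i _; rewrite expr2.
Qed.

Lemma bounded_measurable_coord i :
  bounded_measurable (fun x => vec x i 0).
Proof.
split; first exact: (measurableT_comp (measurable_coord i) (@measurable_vec R n)).
by exists 1 => x; rewrite -(enorm_sphere x); exact: coord_le_enorm.
Qed.

Lemma bounded_measurable_kernel y :
  bounded_measurable (fun x => expR (dotp (vec x) (vec y))).
Proof.
apply/bounded_measurable_expR/bounded_measurable_sum => i.
apply: bounded_measurableM; first exact: bounded_measurable_coord.
exact: bounded_measurable_cst.
Qed.

Lemma bounded_measurable_quad M :
  bounded_measurable (fun x => dotp (vec x) (M *m vec x)).
Proof.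
apply: bounded_measurable_sum => i.
apply: bounded_measurableM; first exact: bounded_measurable_coord.
under eq_fun do rewrite mxE.
apply: bounded_measurable_sum => j.
apply: bounded_measurableM; first exact: bounded_measurable_cst.
exact: bounded_measurable_coord.
Qed.

Lemma quad_charge_setT M a b :
  (quad_charge M a b setT =
   (\int[mu0]_x (a * dotp (vec x) (M *m vec x)) + b)%:E)%E.
Proof.
have bq : bounded_measurable (fun x => a * dotp (vec x) (M *m vec x)).
  by apply: bounded_measurableM; [exact: bounded_measurable_cst|
                                  exact: bounded_measurable_quad].
have bb : bounded_measurable (fun _ : sphereType R n => b).
  exact: bounded_measurable_cst.
have mu01 : mu0 setT = 1%E by exact: probability_setT.
(* The constant [b] is its own mean, since [mu0] has total mass 1. *)
rewrite -[X in _ + X]mulr1 -[X in _ * X]/(fine 1%E) -mu01 -Rintegral_cst//.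
rewrite -RintegralD//; [|exact: bounded_measurable_integrable..].
rewrite /Rintegral fineK//; apply: integrable_fin_num => //.
exact: bounded_measurable_integrable (bounded_measurableD bq bb).
Qed.

Section potentials.
Variables (C1 C2 C3 : R).
Hypothesis C1E : forall y i,
  \int[mu0]_x (expR (dotp (vec x) (vec y)) * vec x i 0) = C1 * vec y i 0.
Hypothesis C23E : forall y i,
  \int[mu0]_x (expR (dotp (vec x) (vec y)) * vec x i 0 ^+ 2) =
  C2 * vec y i 0 ^+ 2 + C3.

Let b_kernel_sqr y i : bounded_measurable
  (fun x => expR (dotp (vec x) (vec y)) * vec x i 0 ^+ 2).
Proof.
apply: bounded_measurableM; first exact: bounded_measurable_kernel.
under eq_fun do rewrite expr2.
by apply: bounded_measurableM; exact: bounded_measurable_coord.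
Qed.

Lemma kernel_linear_potential M y : is_diag_mx M ->
  \int[mu0]_x (expR (dotp (vec x) (vec y)) * dotp (vec x) (M *m vec y)) =
  C1 * dotp (vec y) (M *m vec y).
Proof.
move=> M_diag; under eq_Rintegral => x _.
  rewrite dotp_diag// mulr_sumr; under eq_bigr => i _.
    rewrite (_ : _ * _ = (M i i * vec y i 0) *
      (expR (dotp (vec x) (vec y)) * vec x i 0)); last by ring.
    over.
  over.
rewrite Rintegral_lincomb; last first.
  by move=> i; apply: bounded_measurableM; [exact: bounded_measurable_kernel|
                                            exact: bounded_measurable_coord].
rewrite dotp_diag// mulr_sumr; apply: eq_bigr => i _; rewrite C1E; ring.
Qed.

Lemma kernel_quad_potential M y : is_diag_mx M ->
  \int[mu0]_x (expR (dotp (vec x) (vec y)) * dotp (vec x) (M *m vec x)) =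
  C2 * dotp (vec y) (M *m vec y) + C3 * \tr M.
Proof.
move=> M_diag; under eq_Rintegral => x _.
  rewrite dotp_diag// mulr_sumr; under eq_bigr => i _.
    rewrite (_ : _ * _ = M i i *
      (expR (dotp (vec x) (vec y)) * vec x i 0 ^+ 2)); last by ring.
    over.
  over.
rewrite Rintegral_lincomb// dotp_diag// /mxtrace !mulr_sumr -big_split/=.
by apply: eq_bigr => i _; rewrite C23E; ring.
Qed.

(** On the sphere [1 = x.x], so this is [kernel_quad_potential] for the identity
matrix, where [y.y = 1] and the trace is [n.+1]. *)
Lemma kernel_potential y :
  \int[mu0]_x expR (dotp (vec x) (vec y)) = C2 + C3 *+ n.+1.
Proof.
have dotp1 x : dotp (vec x) (1%:M *m vec x) = 1.
  rewrite mul1mx -(sum_sqr_sphere x).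
  by apply: eq_bigr => i _; rewrite expr2.
have := kernel_quad_potential y (scalar_mx_is_diag _ 1).
rewrite dotp1 mxtrace1 mulr1 mulr_natr => <-.
by apply: eq_Rintegral => x _; rewrite dotp1 mulr1.
Qed.

Lemma quad_charge_potential M a b y : is_diag_mx M ->
  charge_integral (quad_charge M a b)
    (fun x => expR (dotp (vec x) (vec y))) =
  a * C2 * dotp (vec y) (M *m vec y) +
  (a * (C3 * \tr M) + b * (C2 + C3 *+ n.+1)).
Proof.
move=> M_diag; have bk := bounded_measurable_kernel y.
rewrite charge_integral_induced// /quad_density.
have bkq : bounded_measurable
    (fun x => expR (dotp (vec x) (vec y)) * dotp (vec x) (M *m vec x)).
  by apply: bounded_measurableM => //; exact: bounded_measurable_quad.
under eq_Rintegral => x _.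
  rewrite (_ : _ * _ = a * (expR (dotp (vec x) (vec y)) *
    dotp (vec x) (M *m vec x)) + b * expR (dotp (vec x) (vec y))); last by ring.
  over.
rewrite RintegralD//; last 2 first.
- apply: bounded_measurable_integrable.
  by apply: bounded_measurableM => //; exact: bounded_measurable_cst.
- apply: bounded_measurable_integrable.
  by apply: bounded_measurableM => //; exact: bounded_measurable_cst.
rewrite !RintegralZl//; [|exact: bounded_measurable_integrable..].
rewrite kernel_quad_potential// kernel_potential; ring.
Qed.

End potentials.

End sphere.

Theorem theorem4p14 (R : realType) (n : nat) (n_ge2 : (2 <= n.+1)%N)
    (C1 C2 C3 : R) (C1_gt0 : 0 < C1) (C2_gt0 : 0 < C2) (C3_gt0 : 0 < C3)
    (C1E : forall (y : sphereType R n) (i : 'I_n.+1),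
      \int[@uniform_sphere R n]_x
        (expR (dotp (vec x) (vec y)) * vec x i 0) = C1 * vec y i 0)
    (C23E : forall (y : sphereType R n) (i : 'I_n.+1),
      \int[@uniform_sphere R n]_x
        (expR (dotp (vec x) (vec y)) * vec x i 0 ^+ 2) = C2 * vec y i 0 ^+ 2 + C3)
    (M : 'M[R]_n.+1) (M_diag : is_diag_mx M) (eps : R) :
  let alpha := - (C1 / C2) in
  let beta := - \int[@uniform_sphere R n]_x (alpha * dotp (vec x) (M *m vec x)) in
  let nustar := quad_charge M alpha beta in
  (nustar setT = 0)%E /\
  forall nu' : {charge set (sphereType R n) -> \bar R},
    (nu' setT = 0)%E -> energy_variation M eps nustar nu' = 0.
Proof.
move=> alpha beta nustar; split.
  by rewrite quad_charge_setT /beta subrr.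
move=> nu' nu'0; rewrite /energy_variation.
(* [c] collects the part of the potential of [nustar] that is constant in the
   evaluation point. *)
pose c := alpha * (C3 * \tr M) + beta * (C2 + C3 *+ n.+1).
under [X in charge_integral nu' X + _]eq_fun => y.
  rewrite (quad_charge_potential C23E)// -/c.
  over.
under [X in _ + charge_integral nu' X]eq_fun => y.
  rewrite (kernel_linear_potential C1E)//.
  over.
have bq := bounded_measurable_quad M.
have bZ r : bounded_measurable
    (fun y : sphereType R n => r * dotp (vec y) (M *m vec y)).
  by apply: bounded_measurableM => //; exact: bounded_measurable_cst.
rewrite -charge_integralD//; last first.
  by apply: bounded_measurableD => //; exact: bounded_measurable_cst.
(* As [alpha * C2 = - C1], the two quadratic terms cancel. *)
under eq_fun => y.
  rewrite (_ : _ + _ = c); last first.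
    by rewrite /alpha mulNr divfK ?gt_eqF//; ring.
  over.
by rewrite charge_integral_cst nu'0/= !mulr0.
Qed.
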